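(* Consider the optimal control problem $(P^{ode+})$: minimize $$J=E(x(t_0),t_0,p_a;x(t_f),t_f,p_b)+\int_{t_0}^{t_f}F(x(t),u(t),t,p_a,p_b)\,dt$$ over $(x(\cdot),u(\cdot),t_0,t_f,p_a,p_b)$, where $p_a=(s_a,x_a^\sharp,s_a^\sharp)$, $p_b=(s_b,x_b^\sharp,s_b^\sharp)$, subject to $\dot x(t)=f(x(t),u(t),t)$, $u(t)\in U(t)$ and $(x_0,t_0,p_a;x_f,t_f,p_b)\in S_0^{ode+}\times S_f^{ode+}$, with $x_0=x(t_0)$, $x_f=x(t_f)$. Suppose the boundary clock times are uncoordinated and unconstrained, so that $$S_0^{ode+}=\{(x_0,t_0,s_a,x_a^\sharp,s_a^\sharp):\ x_0=x_0(s_a),\ x_0'(s_a)=g_0(x_0(s_a),s_a),\ x_0(s_a^\sharp)=x_a^\sharp,\ (x_a^\sharp,s_a^\sharp)\in P_a,\ t_0\in I_0,\ s_a\in\mathbb R\},$$ $$S_f^{ode+}=\{(x_f,t_f,s_b,x_b^\sharp,s_b^\sharp):\ x_f=x_f(s_b),\ x_f'(s_b)=g_f(x_f(s_b),s_b),\ x_f(s_b^\sharp)=x_b^\sharp,\ (x_b^\sharp,s_b^\sharp)\in P_b,\ t_f\in I_f,\ s_b\in\mathbb R\}.$$ Suppose further that the endpoint cost $E$ and the running cost $F$ are independent of the boundary clock times $s_a$ and $s_b$. Let $\nu^0\ge0$ be the cost multiplier and $\lambda(\cdot)$ the adjoint covector (costate) of Pontryagin's principle for this problem, let $\nu_{t_0}\in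 N_{I_0}(t_0)$ and $\nu_{t_f}\in N_{I_f}(t_f)$ be the multipliers associated with $t_0\in I_0$ and $t_f\in I_f$, and let $\psi_0,\psi_f\in\mathbb R^{N_x}$ be the weak adjoint covectors associated with the boundary differential equations, which are given by $$-\psi_0=\lambda(t_0)+\nu^0\,\partial_{x_0}E,\qquad\psi_f=\lambda(t_f)-\nu^0\,\partial_{x_f}E.$$ Then the transversality and Hamiltonian value conditions for this problem simplify to $$\psi_0^Tg_0(x_0,s_a)=0,\qquad \mathcal H[@t_0]=\nu^0\,\partial_{t_0}E+\nu_{t_0},$$ $$\psi_f^Tg_f(x_f,s_b)=0,\qquad-\mathcal H[@t_f]=\nu^0\,\partial_{t_f}E+\nu_{t_f},$$ where all partial derivatives of $E$ are evaluated at $(x_0,t_0,s_a,x_a^\sharp,s_a^\sharp;x_f,t_f,s_b,x_b^\sharp,s_b^\sharp)$.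
   Context: **Problem data.** $x(t)\in\mathbb R^{N_x}$ is the state, $u(t)\in\mathbb R^{N_u}$ the control, $t$ the clock time, $t_0<t_f$ the initial and final clock times; $(x(\cdot),u(\cdot))$ is an element of some Sobolev space. $U(t)\subset\mathbb R^{N_u}$ is a given compact set for each $t$. The endpoint constraint set is closed. All data functions are continuously differentiable in all their arguments. The dynamics $f$ does not depend on $p_a,p_b$. **Boundary sets.** $p_a,p_b\in\mathbb R\times\mathbb R^{N_x}\times\mathbb R$ are optimization parameters. In $S_0^{ode+}$, $x_0$ is the value at local time $s_a$ of the solution $s\mapsto x_0(s)$ of the boundary ODE $x_0'=g_0(x_0,s)$ through $(x_a^\sharp,s_a^\sharp)$, and similarly for $x_f$ in $S_f^{ode+}$. Here $g_0,g_f:\mathbb R^{N_x}\times\mathbb R\to\mathbb R^{N_x}$ satisfy the conditions of the Picard–Lindelöf theorem (or, if discontinuous in $s$, the Carathéodory conditions); $P_a,P_b\subset\mathbb R^{N_x}\times\mathbb R$; $I_0=[t_0^L,t_0^U]$, $I_f=[t_f^L,t_f^U]$. In general a coordination constraint $\phi_0(s_a,t_0)=0$, $\phi_f(s_b,t_f)=0$ may relate local times and clock times; ''uncoordinated'' means $\phi_0\equiv0\equiv\phi_f$, i.e. no relation is imposed. **Hamiltonians and costate.** $H=\nu^0F(x,u,t,p_a,p_b)+\lambda^Tf(x,u,t)$ with $\nu^0\ge0$. The costate satisfies the adjoint equation $-\dot\lambda(t)=\partial_xH$ along the solution, and $u(t)$ minimizes $H$ over $U(t)$. The lower Hamiltonian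 $\mathcal H$ is the minimum of $H$ over $u\in U(t)$, and $\mathcal H[@t]$ is its value at $(\lambda(t),x(t),t)$ and the parameters of the solution. **Weak adjoint covectors.** $\psi_0$ and $\psi_f$ are the constant multipliers of the boundary ODE constraints written in integral form, $x_0-x_a^\sharp-\int_{s_a^\sharp}^{s_a}g_0(x_0(s),s)\,ds=0$ and $x_f-x_b^\sharp-\int_{s_b^\sharp}^{s_b}g_f(x_f(s),s)\,ds=0$. **Normal cone to an interval.** $\nu\in N_{[a,b]}(t)$ means $\nu\le0$ if $t=a$, $\nu=0$ if $a<t<b$, $\nu\ge0$ if $t=b$, and $\nu$ arbitrary if $a=b$.
   Formalization: When g_0 or g_f satisfies only the Carathéodory conditions, it is additionally assumed continuous at (x_0,s_a), respectively (x_f,s_b); without this, limiting normals at nearby points can violate ψ^T g = 0. *)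

(* Defs.v *)
From HB Require Import structures.
From mathcomp Require Import all_boot all_order all_algebra.
From mathcomp Require Import all_classical all_reals all_analysis.

Set Implicit Arguments.
Unset Strict Implicit.
Unset Printing Implicit Defensive.

Import Order.TTheory GRing.Theory Num.Theory.
Import numFieldNormedType.Exports.

Local Open Scope classical_set_scope.
Local Open Scope ring_scope.

(* An optimization parameter (s, x#, s#). *)
Notation param R n := (R * 'rV[R]_n * R)%type.
(* One end of a trajectory: (state, clock time, parameter). *)
Notation endpoint R n := ('rV[R]_n * R * param R n)%type.

Section Calculus.
Context {R : realType}.

Definition dot n (v w : 'rV[R]_n) : R := \sum_(i < n) v 0 i * w 0 i.

Definition grad n (h : 'rV[R]_n -> R) (x : 'rV[R]_n) : 'rV[R]_n :=
  \row_i 'D_(delta_mx 0 i) h x.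

Definition C1 (V W : normedModType R) (h : V -> W) :=
  (forall z, differentiable h z) /\
  (forall v, continuous (fun z => 'D_v h z)).

(* Only the values of [h] on [a, b] matter; p = +oo is allowed. *)
Definition Lp (p : \bar R) (a b : R) n (h : R -> 'rV[R]_n) :=
  forall i : 'I_n,
    measurable_fun `[a, b] (fun t => h t 0 i) /\
    ('N[@lebesgue_measure R]_p[EFin \o ((fun t => h t 0%R i) \_ `[a, b])%R]
      < +oo)%E.

(* The Sobolev space W^{1,p}(a, b), through absolutely continuous
   representatives: primitives of L^p functions. For p = 1 these are exactly
   the absolutely continuous functions on [a, b]. *)
Definition W1p (p : \bar R) (a b : R) n (h : R -> 'rV[R]_n) :=
  exists2 v : R -> 'rV[R]_n, Lp p a b v &
    forall t, a <= t <= b -> forall i : 'I_n,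
      h t 0 i = h a 0 i + Rintegral lebesgue_measure `[a, t] (fun s => v s 0 i).

Definition ae_solution n (rhs : R -> 'rV[R]_n) (J : set R)
    (h : R -> 'rV[R]_n) :=
  {ae @lebesgue_measure R, forall t, J t -> is_derive t 1 h (rhs t)}.

End Calculus.

Section NormalCones.
Context {R : realType}.

Definition interval_normal_cone (a b t : R) : set R :=
  [set nu | a <= t <= b /\
    (a = b \/ [/\ t = a -> nu <= 0, a < t < b -> nu = 0 & t = b -> 0 <= nu])].

(* Normals to a subset of a finite-dimensional space are covectors, i.e.
   linear forms. Frechet (regular) normals, then their limits at nearby
   points of the set (limiting, or Mordukhovich, normals); pointwise convergence of
   linear forms is convergence in the dual, by finite dimension. *)
Definition frechet_normal (Z : normedModType R) (S : set Z) (z : Z)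
    (zeta : Z -> R) :=
  forall eps : R, 0 < eps ->
    \forall z' \near z, S z' -> zeta (z' - z) <= eps * `|z' - z|.

Definition limiting_normal_cone (Z : normedModType R) (S : set Z) (z : Z) :
    set (Z -> R) :=
  [set zeta | S z /\
    exists (zk : nat -> Z) (zetak : nat -> {linear Z -> R}),
    [/\ forall k, S (zk k),
        forall k, frechet_normal S (zk k) (zetak k),
        zk k @[k --> \oo] --> z &
        forall v, zetak k v @[k --> \oo] --> zeta v]].

End NormalCones.

Section OptimalControl.
Context {R : realType} {Nx Nu : nat}.
Notation X := 'rV[R]_Nx.
Notation Uc := 'rV[R]_Nu.
Notation P := (param R Nx).

Record ocp := OCP {
  endpoint_cost : endpoint R Nx * endpoint R Nx -> R ;
  running_cost : X * Uc * R * P * P -> R ;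
  dynamics : X * Uc * R -> X ;
  control_set : R -> set Uc ;
  endpoint_set : set (endpoint R Nx * endpoint R Nx) }.

Record process := Process {
  traj : R -> X ; ctrl : R -> Uc ; tini : R ; tfin : R ; pini : P ; pfin : P }.

Definition endpoints (w : process) : endpoint R Nx * endpoint R Nx :=
  ((traj w (tini w), tini w, pini w), (traj w (tfin w), tfin w, pfin w)).

Definition run_along (pb : ocp) (w : process) (t : R) : R :=
  running_cost pb (traj w t, ctrl w t, t, pini w, pfin w).

Definition cost (pb : ocp) (w : process) : R :=
  endpoint_cost pb (endpoints w) +
  Rintegral lebesgue_measure `[tini w, tfin w] (run_along pb w).

(* State in W^{1,p}, control in L^q, finite cost. *)
Definition admissible (p q : \bar R) (pb : ocp) (w : process) :=
  [/\ tini w < tfin w,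
      W1p p (tini w) (tfin w) (traj w) /\ Lp q (tini w) (tfin w) (ctrl w),
      ae_solution (fun t => dynamics pb (traj w t, ctrl w t, t))
        `[tini w, tfin w] (traj w),
      forall t, tini w <= t <= tfin w -> control_set pb t (ctrl w t) &
      (@lebesgue_measure R).-integrable `[tini w, tfin w]
        (EFin \o run_along pb w) /\
      endpoint_set pb (endpoints w)].

Definition optimal (p q : \bar R) (pb : ocp) (w : process) :=
  admissible p q pb w /\
  forall w', admissible p q pb w' -> cost pb w <= cost pb w'.

Definition hamiltonian (pb : ocp) (nu0 : R) (lam x : X) (u : Uc) (t : R)
    (pa pb' : P) : R :=
  nu0 * running_cost pb (x, u, t, pa, pb') + dot lam (dynamics pb (x, u, t)).

(* The infimum is a minimum when U(t) is compact and nonempty and the data are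
   continuous. *)
Definition lower_hamiltonian (pb : ocp) (nu0 : R) (lam x : X) (t : R)
    (pa pb' : P) : R :=
  inf [set hamiltonian pb nu0 lam x u t pa pb' | u in control_set pb t].

Definition lower_hamiltonian_at (pb : ocp) (w : process) (nu0 : R)
    (lam : R -> X) (t : R) : R :=
  lower_hamiltonian pb nu0 (lam t) (traj w t) t (pini w) (pfin w).

(* The differential at the endpoints of nu0 * cost, extended by the costate:
   with delta = ((dx0, dt0, dpa), (dxf, dtf, dpb)) it reads
     nu0 * DE(delta) + nu0 * int (d_pa F . dpa + d_pb F . dpb) dt
     + lam(t0) . dx0 - H[@t0] dt0 - lam(tf) . dxf + H[@tf] dtf. *)
Definition endpoint_form (pb : ocp) (w : process) (nu0 : R) (lam : R -> X)
    (delta : endpoint R Nx * endpoint R Nx) : R :=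
  let: ((dx0, dt0, dpa), (dxf, dtf, dpb)) := delta in
  nu0 * 'D_delta (endpoint_cost pb) (endpoints w)
  + nu0 * Rintegral lebesgue_measure `[tini w, tfin w] (fun t =>
      'D_((0, 0, 0, dpa, dpb) : X * Uc * R * P * P) (running_cost pb)
        (traj w t, ctrl w t, t, pini w, pfin w))
  + dot (lam (tini w)) dx0
  - lower_hamiltonian_at pb w nu0 lam (tini w) * dt0
  - dot (lam (tfin w)) dxf
  + lower_hamiltonian_at pb w nu0 lam (tfin w) * dtf.

(* Pontryagin's principle in minimum form: nu0 and lam are a cost multiplier
   and a costate along w. The last clause is the transversality condition for
   an arbitrary endpoint set; it includes the endpoint Hamiltonian values and
   the stationarity in the parameters. *)
Definition pontryagin (pb : ocp) (w : process) (nu0 : R) (lam : R -> X) :=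
  [/\ 0 <= nu0 /\
      ~ (nu0 = 0 /\ forall t, tini w <= t <= tfin w -> lam t = 0),
      W1p 1 (tini w) (tfin w) lam,
      ae_solution (fun t => - grad (fun y =>
          hamiltonian pb nu0 (lam t) y (ctrl w t) t (pini w) (pfin w))
          (traj w t)) `[tini w, tfin w] lam,
      {ae @lebesgue_measure R, forall t, tini w <= t <= tfin w ->
        control_set pb t (ctrl w t) /\ forall v, control_set pb t v ->
        hamiltonian pb nu0 (lam t) (traj w t) (ctrl w t) t (pini w) (pfin w)
        <= hamiltonian pb nu0 (lam t) (traj w t) v t (pini w) (pfin w)} &
      limiting_normal_cone (endpoint_set pb) (endpoints w)
        (fun delta => - endpoint_form pb w nu0 lam delta)].

End OptimalControl.
Arguments ocp : clear implicits.
Arguments process : clear implicits.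

Section BoundaryODE.
Context {R : realType} {n : nat}.
Notation X := 'rV[R]_n.

Definition picard_lindelof (g : X -> R -> X) :=
  continuous (fun z : X * R => g z.1 z.2) /\
  forall x s, exists L r : R, 0 < r /\
    forall y y' sg, `|y - x| < r -> `|y' - x| < r -> `|sg - s| < r ->
      `|g y sg - g y' sg| <= L * `|y - y'|.

Definition caratheodory (g : X -> R -> X) :=
  [/\ {ae @lebesgue_measure R, forall s, continuous (g ^~ s)},
      forall y (i : 'I_n), measurable_fun setT (fun s => g y s 0 i) &
      forall r a b : R, exists2 m : R -> R,
        (@lebesgue_measure R).-integrable `[a, b] (EFin \o m) &
        {ae @lebesgue_measure R, forall s, a <= s <= b ->
          forall y, `|y| <= r -> `|g y s| <= m s}].

(* The Caratheodory conditions leave the value of g at one given time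
   arbitrary, so a pointwise statement about g x s makes sense only if g is
   continuous at (x, s). *)
Definition boundary_rhs (g : X -> R -> X) (x : X) (s : R) :=
  picard_lindelof g \/
  (caratheodory g /\ {for (x, s), continuous (fun z : X * R => g z.1 z.2)}).

(* Solutions are local: they live on some open interval containing both local
   times. They satisfy the ODE in the Caratheodory sense, and classically at
   s; for continuous g this is the same as being a classical solution. *)
Definition boundary_set (g : X -> R -> X) (Q : set (X * R)) (tL tU : R) :
    set (endpoint R n) :=
  [set z | let: (x, t, (s, xsharp, ssharp)) := z in
    (exists (y : R -> X) (c d : R),
      [/\ c < s < d /\ c < ssharp < d,
          forall a b, c < a -> a < b -> b < d -> W1p 1 a b y,
          ae_solution (fun sg => g (y sg) sg) `]c, d[ y &
          [/\ x = y s, is_derive s 1 y (g (y s) s) & y ssharp = xsharp]]) /\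
    Q (xsharp, ssharp) /\ tL <= t <= tU].

End BoundaryODE.

(* Main.v *)
(* The product structure splits the limiting normal of the transversality
   condition into a normal zeta to each boundary set. Such a set is invariant
   under moving the clock time inside its interval and under flowing the state
   along the boundary ODE while the local time advances, so a Frechet normal is
   tested on the directions (0, 1, 0) and (g x s, 0, (1, 0, 0)): the first gives
   the interval normal cone, the second gives zeta(g x s, 0, (1, 0, 0)) = 0.
   Both pass to the limit because normals converge in a finite-dimensional dual
   and g is continuous at (x, s). As E and F do not depend on the local times,
   the values of zeta on these directions are the asserted conditions. *)

Require Import Defs.
From HB Require Import structures.
From mathcomp Require Import all_boot all_order all_algebra.
From mathcomp Require Import all_classical all_reals all_analysis.
From mathcomp Require Import lra.
Set Implicit Arguments.
Unset Strict Implicit.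
Unset Printing Implicit Defensive.
Import Order.TTheory GRing.Theory Num.Theory.
Import numFieldNormedType.Exports.
Local Open Scope classical_set_scope.
Local Open Scope ring_scope.

(** * Embeddings of factors and continuity of the duality pairing *)

(** Named maps, rather than bare pairs, so that a linear form composed with an embedding is again
    inferred to be linear. *)
Definition in_left {R : realType} {V W : normedModType R} (v : V) : V * W :=
  (v, 0).
Definition in_right {R : realType} {V W : normedModType R} (w : W) : V * W :=
  (0, w).

Lemma in_left_linear (R : realType) (V W : normedModType R) :
  linear (@in_left R V W).
Proof.
by move=> a u v; apply/pair_equal_spec; split=> //=; rewrite scaler0 addr0.
Qed.

Lemma in_right_linear (R : realType) (V W : normedModType R) :
  linear (@in_right R V W).
Proof.
by move=> a u v; apply/pair_equal_spec; split=> //=; rewrite scaler0 addr0.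
Qed.

HB.instance Definition _ (R : realType) (V W : normedModType R) :=
  GRing.isLinear.Build R V (V * W)%type *:%R in_left (@in_left_linear R V W).
HB.instance Definition _ (R : realType) (V W : normedModType R) :=
  GRing.isLinear.Build R W (V * W)%type *:%R in_right (@in_right_linear R V W).

(* Joint sequential continuity of the duality pairing, a form of finite
   dimensionality that is inherited by products. *)
Definition pairing_cvg {R : realType} (V : normedModType R) :=
  forall (l_ : nat -> {linear V -> R}) (l : V -> R) (v_ : nat -> V) (v : V),
    (forall e, l_ k e @[k --> \oo] --> l e) -> v_ k @[k --> \oo] --> v ->
    l_ k (v_ k) @[k --> \oo] --> l v.

Lemma pairing_cvg_real (R : realType) : pairing_cvg (R : normedModType R).
Proof.
move=> l_ l v_ v l_l v_v.
have lE k (a : R) : l_ k a = a * l_ k 1.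
  by rewrite -[in LHS](mulr1 a) [LHS]linearZ.
have key (u_ : nat -> R) (u : R) : u_ k @[k --> \oo] --> u ->
    l_ k (u_ k) @[k --> \oo] --> u * l 1.
  move=> u_u; rewrite (eq_cvg _ _ (fun k => lE k (u_ k))).
  by apply: cvgM => //; exact: l_l.
(* The limit form [l] is known only pointwise; applying [key] to a constant sequence identifies its
   value at [v], by uniqueness of limits. *)
have -> : l v = v * l 1.
  exact: (cvg_unique (@Rhausdorff R) (l_l v) (key _ _ (cvg_cst v))).
exact: key.
Qed.

Lemma pairing_cvg_row (R : realType) n : pairing_cvg 'rV[R]_n.
Proof.
move=> l_ l v_ v l_l v_v.
have lE k u : l_ k u = \sum_(j < n) u 0 j * l_ k (delta_mx 0 j).
  rewrite [in LHS](row_sum_delta u) linear_sum.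
  by apply: eq_bigr => j _; rewrite linearZ.
have key (u_ : nat -> 'rV[R]_n) (u : 'rV[R]_n) : u_ k @[k --> \oo] --> u ->
    l_ k (u_ k) @[k --> \oo] --> \sum_(j < n) u 0 j * l (delta_mx 0 j).
  move=> u_u; rewrite (eq_cvg _ _ (fun k => lE k (u_ k))).
  apply: cvg_big => //=; first exact: add_continuous.
  move=> j _; apply: cvgM; last exact: l_l.
  exact: (cvg_comp _ _ u_u (@coord_continuous _ _ _ 0 j u)).
have -> : l v = \sum_(j < n) v 0 j * l (delta_mx 0 j).
  exact: (cvg_unique (@Rhausdorff R) (l_l v) (key _ _ (cvg_cst v))).
exact: key.
Qed.

Lemma pairing_cvg_prod (R : realType) (V W : normedModType R) :
  pairing_cvg V -> pairing_cvg W -> pairing_cvg (V * W)%type.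
Proof.
move=> hV hW l_ l v_ v l_l v_v.
have lE k (a : V) (b : W) : l_ k (a, b) = l_ k (in_left a) + l_ k (in_right b).
  rewrite -raddfD; congr (l_ k _).
  by apply/pair_equal_spec; split; rewrite /= ?addr0 ?add0r.
have v1 : (v_ k).1 @[k --> \oo] --> v.1.
  by apply: cvg_comp v_v _; exact: cvg_fst.
have v2 : (v_ k).2 @[k --> \oo] --> v.2.
  by apply: cvg_comp v_v _; exact: cvg_snd.
have key (u_ : nat -> V * W) u : (u_ k).1 @[k --> \oo] --> u.1 ->
    (u_ k).2 @[k --> \oo] --> u.2 ->
    l_ k (u_ k) @[k --> \oo] --> l (in_left u.1) + l (in_right u.2).
  move=> u1 u2.
  have uE k : l_ k (u_ k) = l_ k (in_left (u_ k).1) + l_ k (in_right (u_ k).2).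
    by rewrite -lE -surjective_pairing.
  rewrite (eq_cvg _ _ uE).
  apply: cvgD.
    pose lL k : {linear V -> R} := l_ k \o in_left.
    exact: (hV lL (l \o in_left) _ _ (fun=> l_l _) u1).
  pose lR k : {linear W -> R} := l_ k \o in_right.
  exact: (hW lR (l \o in_right) _ _ (fun=> l_l _) u2).
have -> : l v = l (in_left v.1) + l (in_right v.2).
  by apply: (cvg_unique (@Rhausdorff R) (l_l v) (key _ _ _ _)); exact: cvg_cst.
exact: key.
Qed.

(** * Frechet normals: tangent directions and products *)

(** Frechet normals lie in the polar of the contingent (Bouligand) cone: divide the normal
    inequality at [z + tau_ k *: d_ k] by [tau_ k], let [k] grow, then let the tolerance vanish. *)
Lemma frechet_normal_contingent (R : realType) (Z : normedModType R)
    (S : set Z) (z d : Z) (l : {linear Z -> R}) (tau_ : nat -> R)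
    (d_ : nat -> Z) :
  pairing_cvg Z -> frechet_normal S z l ->
  (forall k, 0 < tau_ k) -> tau_ k @[k --> \oo] --> 0 ->
  d_ k @[k --> \oo] --> d -> (forall k, S (z + tau_ k *: d_ k)) -> l d <= 0.
Proof.
move=> hZ nS tau_gt0 tau0 d_d S_.
have ld : l (d_ k) @[k --> \oo] --> l d.
  by apply: (hZ (fun=> l)) d_d => e; exact: cvg_cst.
have z_z : z + tau_ k *: d_ k @[k --> \oo] --> z.
  rewrite -[X in _ --> X](addr0 z) -(scale0r d).
  by apply: cvgD; [exact: cvg_cst|exact: cvgZ].
apply/ler_addgt0Pr => e e_gt0; rewrite add0r.
have c_gt0 : 0 < `|d| + 1 by rewrite ltr_wpDl.
(* Chosen so that [eps * |d|] is at most [e]; the added 1 keeps the denominator positive when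
   [d = 0]. *)
pose eps := e / (`|d| + 1).
have eps_gt0 : 0 < eps by rewrite divr_gt0.
have le_d : l d <= eps * `|d|.
  have nd : eps * `|d_ k| @[k --> \oo] --> eps * `|d|.
    by apply: cvgM; [exact: cvg_cst|exact: cvg_norm].
  apply: (ler_cvg_to ld nd).
  have ev : \forall k \near \oo, S (z + tau_ k *: d_ k) ->
      l (z + tau_ k *: d_ k - z) <= eps * `|z + tau_ k *: d_ k - z|.
    exact: z_z _ (nS _ eps_gt0).
  apply: filterS ev => k /(_ (S_ k)).
  rewrite addrC addKr linearZ normrZ gtr0_norm // mulrCA.
  by rewrite /= /GRing.scale /= ler_pM2l.
apply: (le_trans le_d); rewrite /eps mulrAC ler_pdivrMr //.
by rewrite ler_pM2l // lerDl.
Qed.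

(** Test the normal only at points of the slice where the second component is frozen; there the max
    norm of the product is the norm of the first factor. *)
Lemma frechet_normal_prod_left (R : realType) (V W : normedModType R)
    (A : set V) (B : set W) (z : V * W) (l : V * W -> R) :
  B z.2 -> frechet_normal (A `*` B) z l -> frechet_normal A z.1 (l \o in_left).
Proof.
case: z => a b /= Bb nAB eps eps_gt0.
have ab : (v, b) @[v --> a] --> (a, b).
  by apply: cvg_pair; [exact: cvg_id|exact: cvg_cst].
have ev : \forall v \near a, (A `*` B) (v, b) ->
    l ((v, b) - (a, b)) <= eps * `|(v, b) - (a, b)|.
  exact: ab _ (nAB _ eps_gt0).
apply: filterS ev => v nv Av; have := nv (conj Av Bb).
have -> : (v, b) - (a, b) = in_left (v - a).
  by apply/pair_equal_spec; split=> //=; rewrite subrr.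
by rewrite [`|in_left _|]prod_normE /= normr0 (max_l (normr_ge0 _)).
Qed.

Lemma frechet_normal_prod_right (R : realType) (V W : normedModType R)
    (A : set V) (B : set W) (z : V * W) (l : V * W -> R) :
  A z.1 -> frechet_normal (A `*` B) z l -> frechet_normal B z.2 (l \o in_right).
Proof.
case: z => a b /= Aa nAB eps eps_gt0.
have ab : (a, w) @[w --> b] --> (a, b).
  by apply: cvg_pair; [exact: cvg_cst|exact: cvg_id].
have ev : \forall w \near b, (A `*` B) (a, w) ->
    l ((a, w) - (a, b)) <= eps * `|(a, w) - (a, b)|.
  exact: ab _ (nAB _ eps_gt0).
apply: filterS ev => w nw Bw; have := nw (conj Aa Bw).
have -> : (a, w) - (a, b) = in_right (w - b).
  by apply/pair_equal_spec; split=> //=; rewrite subrr.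
by rewrite [`|in_right _|]prod_normE /= normr0 (max_r (normr_ge0 _)).
Qed.

Lemma limiting_normal_cone_prod (R : realType) (V W : normedModType R)
    (A : set V) (B : set W) (z : V * W) (l : V * W -> R) :
  limiting_normal_cone (A `*` B) z l ->
  limiting_normal_cone A z.1 (l \o in_left) /\
  limiting_normal_cone B z.2 (l \o in_right).
Proof.
move=> [[Az Bz] [z_ [l_ [ABz_ n_ z_z l_l]]]]; split; split=> //.
- exists (fun k => (z_ k).1), (fun k => l_ k \o in_left); split.
  + by move=> k; have [] := ABz_ k.
  + move=> k; apply: frechet_normal_prod_left (n_ k).
    by have [] := ABz_ k.
  + by apply: cvg_comp z_z _; exact: cvg_fst.
  + by move=> v; exact: l_l.
- exists (fun k => (z_ k).2), (fun k => l_ k \o in_right); split.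
  + by move=> k; have [] := ABz_ k.
  + move=> k; apply: frechet_normal_prod_right (n_ k).
    by have [] := ABz_ k.
  + by apply: cvg_comp z_z _; exact: cvg_snd.
  + by move=> v; exact: l_l.
Qed.

(** A nonempty open interval has positive length, so it cannot lie in the exceptional null set. *)
Lemma ae_ex_itv (R : realType) (P : R -> Prop) (a b : R) :
  {ae @lebesgue_measure R, forall t, P t} -> a < b ->
  exists t, a < t < b /\ P t.
Proof.
move=> aeP ab; apply: contrapT => noP.
have N : (@lebesgue_measure R).-negligible `]a, b[%classic.
  apply: negligibleS aeP => t /=; rewrite in_itv /= => tab Pt.
  by apply: noP; exists t.
have : lebesgue_measure `]a, b[%classic = 0%E :> \bar R.
  by apply/negligibleP => //; exact: measurable_itv.
rewrite /= lebesgue_measure_itv /= lte_fin ab -EFinD => /eqP.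
by rewrite eqe subr_eq0 (gt_eqF ab).
Qed.

Lemma pairing_cvg_endpoint (R : realType) n : pairing_cvg (endpoint R n).
Proof.
have hR := @pairing_cvg_real R; have hV := @pairing_cvg_row R n.
apply: pairing_cvg_prod; apply: pairing_cvg_prod => //.
exact: pairing_cvg_prod.
Qed.

Lemma endpoint_addZ (R : realType) n (x y v w : 'rV[R]_n) (s t ss a b c k : R) :
  (x, t, (s, y, ss)) + k *: (v, a, (b, w, c)) =
  (x + k *: v, t + k * a, (s + k * b, y + k *: w, ss + k * c)) :> endpoint R n.
Proof. by []. Qed.

(** * Normals to a boundary set *)

Section BoundarySet.
Context {R : realType} {n : nat}.
Variables (g : 'rV[R]_n -> R -> 'rV[R]_n) (Q : set ('rV[R]_n * R)) (tL tU : R).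
Let S := boundary_set g Q tL tU.

(** The solution curve witnessing membership at [s] also witnesses it at nearby local times.
    Following it forward and backward makes the direction and its opposite contingent, so [l] is
    both nonpositive and nonnegative there. *)
Lemma boundary_set_frechet_ode x t s xs ss (l : {linear endpoint R n -> R}) :
  S (x, t, (s, xs, ss)) -> frechet_normal S (x, t, (s, xs, ss)) l ->
  l (g x s, 0, (1, 0, 0)) = 0.
Proof.
move=> [[y [c [d [[/andP[cs sd] cssd] Wy aey [xE dy ysE]]]]] [Qxs tt]] nS.
pose e : endpoint R n := (g x s, 0, (1, 0, 0)).
(* In the Caratheodory case the curve stays in S only at almost every local
   time, which is enough to approach s from both sides. *)
have ex_h sg eps : sg = 1 \/ sg = -1 -> 0 < eps -> exists h, 0 < h < eps /\
    S (y (s + sg * h), t, (s + sg * h, xs, ss)).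
  (* This radius keeps the new local time inside the solution interval and within [eps] of [s]. *)
  move=> sg1 eps_gt0; pose r := Num.min eps (Num.min (d - s) (s - c)).
  have r_gt0 : 0 < r by rewrite !lt_min eps_gt0 !subr_gt0 sd cs.
  have [rk rd rc] : [/\ r <= eps, r <= d - s & r <= s - c].
    by split; rewrite !ge_min lexx ?orbT.
  have Sy v : s - r < v < s + r ->
      (`]c, d[%classic v -> is_derive v 1 y (g (y v) v)) ->
      S (y v, t, (v, xs, ss)).
    move=> /andP[rv vr] dyv; split=> //.
    have cvd : c < v < d by apply/andP; split; lra.
    exists y, c, d; split=> //; split=> //.
    by apply: dyv; rewrite /= in_itv.
  case: sg1 => ->.
    have [|v [/andP[sv vr] dyv]] := ae_ex_itv aey (_ : s < s + r).
      by rewrite ltrDl.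
    exists (v - s); rewrite mul1r subrKC; split.
      by apply/andP; split; lra.
    by apply: Sy dyv; apply/andP; split; lra.
  have [|v [/andP[rv vs] dyv]] := ae_ex_itv aey (_ : s - r < s).
    by rewrite gtrDl oppr_lt0.
  exists (s - v); rewrite mulN1r opprB subrKC; split.
    by apply/andP; split; lra.
  by apply: Sy dyv; apply/andP; split; lra.
have qcvg (h_ : nat -> R) :
    (forall k, h_ k != 0) -> h_ k @[k --> \oo] --> 0 ->
    (h_ k)^-1 *: (y (s + h_ k) - y s) @[k --> \oo] --> g x s.
  move=> h_neq0 h0.
  (* The derivative is a limit over punctured neighbourhoods, hence the need for nonzero
     increments. *)
  have h0' : h_ k @[k --> \oo] --> 0^'.
    move=> A A0.
    have ev : \forall k \near \oo, h_ k != 0 -> A (h_ k) := h0 _ A0.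
    by apply: filterS ev => k; exact.
  have [dy1 dy2] := dy.
  have qy : h^-1 *: ((y \o shift s) (h *: 1) - y s) @[h --> 0^'] --> g (y s) s.
    by rewrite -dy2; exact: dy1.
  have qE k : (h_ k)^-1 *: (y (s + h_ k) - y s) =
      (h_ k)^-1 *: ((y \o shift s) (h_ k *: 1) - y s).
    by rewrite /= [_ *: 1]mulr1 [s + _]addrC.
  by rewrite (eq_cvg _ _ qE) xE; exact: (cvg_comp _ _ h0' qy).
suff le0 sg : sg = 1 \/ sg = -1 -> l (sg *: e) <= 0.
  apply/eqP; rewrite eq_le -[X in l X <= 0](scale1r e) le0 /=; last by left.
  by rewrite -oppr_le0 -raddfN -scaleN1r le0 //; right.
move=> sg1; have sgsg : sg * sg = 1.
  by case: sg1 => ->; rewrite ?mulr1 ?mulrN1 ?opprK.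
have sg0 : sg != 0.
  by apply: contra_eq_neq sgsg => ->; rewrite mul0r eq_sym oner_neq0.
have [h_ h_P] := choice (fun k => ex_h sg _ sg1 (harmonic_gt0 k)).
have h0 : h_ k @[k --> \oo] --> 0.
  apply: (@squeeze_cvgr _ _ _ _ (cst 0) harmonic); last exact: cvg_harmonic.
    by apply: nearW => k; have [/andP[/ltW -> /ltW]] := h_P k.
  exact: cvg_cst.
(* Steps must be positive, so the sign [sg] sits in the direction: a step [h_ k] along [d_ k] lands
   exactly on the curve at local time [s + sg * h_ k]. *)
pose d_ k : endpoint R n :=
  sg *: ((sg * h_ k)^-1 *: (y (s + sg * h_ k) - y s), 0, (1, 0, 0)).
apply: (frechet_normal_contingent (tau_ := h_) (d_ := d_) (d := sg *: e)
  (@pairing_cvg_endpoint R n) nS).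
- by move=> k; have [/andP[]] := h_P k.
- exact: h0.
- have q_ : (sg * h_ k)^-1 *: (y (s + sg * h_ k) - y s)
      @[k --> \oo] --> g x s.
    apply: (qcvg (fun k => sg * h_ k)).
      move=> k; have [/andP[hk0 _] _] := h_P k.
      by rewrite mulf_neq0 // gt_eqF.
    by rewrite -(mulr0 sg); apply: cvgM h0; exact: cvg_cst.
  have q0 : ((sg * h_ k)^-1 *: (y (s + sg * h_ k) - y s), 0 : R)
      @[k --> \oo] --> (g x s, 0 : R).
    exact: (cvg_pair q_ (cvg_cst (0 : R))).
  have d_e : ((sg * h_ k)^-1 *: (y (s + sg * h_ k) - y s), 0, (1, 0, 0))
      @[k --> \oo] --> (g x s, 0 : R, (1 : R, 0 : 'rV[R]_n, 0 : R)).
    exact: (cvg_pair q0 (cvg_cst (1 : R, 0 : 'rV[R]_n, 0 : R))).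
  rewrite /d_; apply: cvgZ; first exact: cvg_cst.
  exact: d_e.
- move=> k; have [/andP[hk0 _]] := h_P k.
  rewrite scalerA endpoint_addZ !mulr0 scaler0 !addr0 mulr1 [h_ k * _]mulrC.
  by rewrite scalerA divff ?mulf_neq0 ?(gt_eqF hk0) // scale1r xE subrKC.
Qed.

(** The clock time enters the set only through its interval, so moving it alone toward an endpoint
    not yet reached is feasible. *)
Lemma boundary_set_frechet_time x t s xs ss (l : {linear endpoint R n -> R}) :
  S (x, t, (s, xs, ss)) -> frechet_normal S (x, t, (s, xs, ss)) l ->
  (t < tU -> l (0, 1, 0) <= 0) /\ (tL < t -> 0 <= l (0, 1, 0)).
Proof.
move=> [ode [Qxs /andP[tLt ttU]]] nS.
have move_time (c : R) : (forall h, 0 < h <= 1 -> tL <= t + h * c <= tU) ->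
    l (0, c, 0) <= 0.
  move=> hc; pose d : endpoint R n := (0, c, (0, 0, 0)).
  apply: (frechet_normal_contingent (tau_ := harmonic) (d_ := fun=> d) (d := d)
    (@pairing_cvg_endpoint R n) nS).
  - by move=> k; exact: harmonic_gt0.
  - exact: cvg_harmonic.
  - exact: cvg_cst.
  - move=> k; rewrite endpoint_addZ !mulr0 !scaler0 !addr0.
    split=> //; split=> //; apply: hc; rewrite harmonic_gt0 /=.
    by rewrite invf_le1 ?ler1n.
have le0 c : l (0, c, 0) = c * l (0, 1, 0).
  rewrite -[RHS]linearZ; congr (l _).
  by rewrite -[RHS]add0r [RHS]endpoint_addZ !scaler0 !mulr0 mulr1 !addr0 add0r.
(* The displacements [tU - t] and [tL - t] stay feasible for every step in ]0, 1] by convexity of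
   the interval; homogeneity then returns to the unit direction. *)
split=> [tltU|tLltt].
  have : l (0, tU - t, 0) <= 0.
    by apply: move_time => h /andP[h_gt0 h1]; apply/andP; split; nra.
  by rewrite le0 pmulr_rle0 // subr_gt0.
have : l (0, tL - t, 0) <= 0.
  by apply: move_time => h /andP[h_gt0 h1]; apply/andP; split; nra.
by rewrite le0 nmulr_rle0 // subr_lt0.
Qed.

(** The annihilated direction moves with the approximating point, so form and argument converge
    together: this is where [pairing_cvg] is used with a nonconstant sequence. *)
Lemma boundary_set_limiting_ode z x t s xs ss :
  {for (x, s), continuous (fun w : 'rV[R]_n * R => g w.1 w.2)} ->
  limiting_normal_cone S (x, t, (s, xs, ss)) z ->
  z (g x s, 0, (1, 0, 0)) = 0.
Proof.
move=> gxs [_ [z_ [l_ [Sz_ n_ z_z l_l]]]].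
pose e_ k : endpoint R n := (g (z_ k).1.1 (z_ k).2.1.1, 0, (1, 0, 0)).
have le0 k : l_ k (e_ k) = 0.
  rewrite /e_; move: (Sz_ k) (n_ k).
  by case: (z_ k) => [[x' t'] [[s' xs'] ss']]; exact: boundary_set_frechet_ode.
have x_x : (z_ k).1.1 @[k --> \oo] --> x.
  apply: (cvg_comp _ _ (cvg_comp _ _ z_z cvg_fst)); exact: cvg_fst.
have s_s : (z_ k).2.1.1 @[k --> \oo] --> s.
  apply: (cvg_comp _ _ (cvg_comp _ _ (cvg_comp _ _ z_z cvg_snd) cvg_fst)).
  exact: cvg_fst.
have g_g : g (z_ k).1.1 (z_ k).2.1.1 @[k --> \oo] --> g x s.
  exact: (cvg_comp _ _ (cvg_pair x_x s_s) gxs).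
have e_e : e_ k @[k --> \oo] --> ((g x s, 0, (1, 0, 0)) : endpoint R n).
  have g0 : (g (z_ k).1.1 (z_ k).2.1.1, 0 : R) @[k --> \oo] --> (g x s, 0 : R).
    exact: (cvg_pair g_g (cvg_cst (0 : R))).
  exact: (cvg_pair g0 (cvg_cst (1 : R, 0 : 'rV[R]_n, 0 : R))).
have := pairing_cvg_endpoint l_l e_e.
rewrite (eq_cvg _ _ le0) => z0.
exact: (cvg_unique (@Rhausdorff R) z0 (cvg_cst 0)).
Qed.

(** A strict inequality between [t] and an endpoint holds eventually along the approximating clock
    times, so the sign of their normals survives in the limit. *)
Lemma boundary_set_limiting_time z x t s xs ss :
  limiting_normal_cone S (x, t, (s, xs, ss)) z ->
  interval_normal_cone tL tU t (z (0, 1, 0)).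
Proof.
move=> [[_ [_ tt]] [z_ [l_ [Sz_ n_ z_z l_l]]]]; split=> //.
have t_t : (z_ k).1.2 @[k --> \oo] --> t.
  apply: (cvg_comp _ _ (cvg_comp _ _ z_z cvg_fst)); exact: cvg_snd.
have lk k : ((z_ k).1.2 < tU -> l_ k (0, 1, 0) <= 0) /\
    (tL < (z_ k).1.2 -> 0 <= l_ k (0, 1, 0)).
  move: (Sz_ k) (n_ k).
  by case: (z_ k) => [[x' t'] [[s' xs'] ss']]; exact: boundary_set_frechet_time.
have le0 : t < tU -> z (0, 1, 0) <= 0.
  move=> ttU; apply: (ler_cvg_to (l_l (0, 1, 0)) (cvg_cst 0)).
  by apply: filterS (cvgr_lt _ t_t _ ttU) => k; have [] := lk k.
have ge0 : tL < t -> 0 <= z (0, 1, 0).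
  move=> tLt; apply: (ler_cvg_to (cvg_cst 0) (l_l (0, 1, 0))).
  by apply: filterS (cvgr_gt _ t_t _ tLt) => k; have [] := lk k.
(* A degenerate interval imposes no sign; otherwise each endpoint is strictly away from the other,
   and one of [le0], [ge0] applies. *)
case: (eqVneq tL tU) => [|tLU]; [by left|right].
have {tLU} tLU : tL < tU.
  by move: tt => /andP[? ?]; rewrite lt_neqAle tLU (le_trans _ (_ : t <= tU)).
split=> [tE|/andP[tLt ttU]|tE].
- by apply: le0; rewrite tE.
- by apply/eqP; rewrite eq_le le0 // ge0.
- by apply: ge0; rewrite tE.
Qed.

End BoundarySet.

(** * Directional derivatives and partial gradients *)

(** A directional derivative sees only the restriction to one line: the difference quotients are
    equal as functions, hence so are their limits. *)
Lemma derive_line_ext (R : realType) (V W : normedModType R) (f : V -> R)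
    (h : W -> R) (z v : V) (y w : W) :
  (forall a : R, f (a *: v + z) = h (a *: w + y)) -> 'D_v f z = 'D_w h y.
Proof.
move=> fh; have fz : f z = h y by have := fh 0; rewrite !scale0r !add0r.
suff dfE : (fun a : R => a^-1 *: ((f \o shift z) (a *: v) - f z)) =
    (fun a : R => a^-1 *: ((h \o shift y) (a *: w) - h y)).
  by rewrite /derive dfE.
by apply/funext => a /=; rewrite fz fh.
Qed.

Lemma derive_line_cst (R : realType) (V : normedModType R) (f : V -> R)
    (z v : V) : (forall a : R, f (a *: v + z) = f z) -> 'D_v f z = 0.
Proof.
move=> fz; rewrite (@derive_line_ext _ _ R _ (cst (f z)) _ _ 0 0) //.
exact: derive_cst.
Qed.

(** Links a gradient in one block of variables, with the others frozen, to the full differential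
    along the embedding [j] of that block. *)
Lemma dot_grad (R : realType) (Z : normedModType R) n (f : Z -> R)
    (h : 'rV[R]_n -> R) (z : Z) (j : {linear 'rV[R]_n -> Z}) (x v : 'rV[R]_n) :
  differentiable f z -> (forall y, f (j y + z) = h (y + x)) ->
  dot (grad h x) v = 'D_(j v) f z.
Proof.
move=> df fh; rewrite deriveE // {2}(row_sum_delta v) !linear_sum.
apply: eq_bigr => i _; rewrite !linearZ mxE mulrC -deriveE //.
congr (_ * _); symmetry; apply: derive_line_ext => a.
by rewrite -linearZ fh.
Qed.

Lemma dot0r (R : realType) n (v : 'rV[R]_n) : dot v 0 = 0.
Proof. by rewrite /dot big1 // => i _; rewrite mxE mulr0. Qed.

Lemma dotDl (R : realType) n (u v w : 'rV[R]_n) :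
  dot (u + v) w = dot u w + dot v w.
Proof. by rewrite -big_split; apply: eq_bigr => i _; rewrite mxE mulrDl. Qed.

Lemma dotZl (R : realType) n a (v w : 'rV[R]_n) : dot (a *: v) w = a * dot v w.
Proof. by rewrite mulr_sumr; apply: eq_bigr => i _; rewrite mxE mulrA. Qed.

Lemma dotNl (R : realType) n (v w : 'rV[R]_n) : dot (- v) w = - dot v w.
Proof. by rewrite -scaleN1r dotZl mulN1r. Qed.

Lemma boundary_rhs_continuous (R : realType) n
    (g : 'rV[R]_n -> R -> 'rV[R]_n) x s : boundary_rhs g x s ->
  {for (x, s), continuous (fun z : 'rV[R]_n * R => g z.1 z.2)}.
Proof. by case=> [[gC _]|[_ //]]; exact: gC. Qed.

Lemma Rintegral_eq0 d (T : measurableType d) (R : realType)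
    (mu : {measure set T -> \bar R}) (D : set T) (f : T -> R) :
  (forall t, f t = 0) -> Rintegral mu D f = 0.
Proof.
by move=> f0; rewrite /Rintegral integral0_eq // => t _ /=; rewrite f0.
Qed.

(** Stated as a pair of equations so that a single [rewrite] applies both. *)
Lemma pair_linearE (R : realType) (V W : normedModType R) :
  (forall (a c : V) (b d : W), (a, b) + (c, d) = (a + c, b + d)) *
  (forall k (a : V) (b : W), k *: (a, b) = (k *: a, k *: b)).
Proof. by []. Qed.

(** * Evaluation of the transversality condition *)

Theorem corollary2 (R : realType) (Nx Nu : nat)
  (E : endpoint R Nx * endpoint R Nx -> R)
  (F : 'rV[R]_Nx * 'rV[R]_Nu * R * param R Nx * param R Nx -> R)
  (f : 'rV[R]_Nx * 'rV[R]_Nu * R -> 'rV[R]_Nx)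
  (U : R -> set 'rV[R]_Nu)
  (g0 gf : 'rV[R]_Nx -> R -> 'rV[R]_Nx)
  (Pa Pb : set ('rV[R]_Nx * R))
  (t0L t0U tfL tfU : R)
  (p q : \bar R) (p_ge1 : (1 <= p)%E) (q_ge1 : (1 <= q)%E)
  (E_C1 : C1 E) (F_C1 : C1 F) (f_C1 : C1 f)
  (U_compact : forall t, compact (U t))
  (S0 := boundary_set g0 Pa t0L t0U)
  (Sf := boundary_set gf Pb tfL tfU)
  (S_closed : closed (S0 `*` Sf))
  (E_indep : forall x0 t0 sa sa' xa sa0 xf tf sb sb' xb sb0,
     E ((x0, t0, (sa, xa, sa0)), (xf, tf, (sb, xb, sb0))) =
     E ((x0, t0, (sa', xa, sa0)), (xf, tf, (sb', xb, sb0))))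
  (F_indep : forall y v t sa sa' xa sa0 sb sb' xb sb0,
     F (y, v, t, (sa, xa, sa0), (sb, xb, sb0)) =
     F (y, v, t, (sa', xa, sa0), (sb', xb, sb0)))
  (x : R -> 'rV[R]_Nx) (u : R -> 'rV[R]_Nu) (t0 tf : R)
  (sa : R) (xa : 'rV[R]_Nx) (sa0 : R) (sb : R) (xb : 'rV[R]_Nx) (sb0 : R)
  (g0_ok : boundary_rhs g0 (x t0) sa)
  (gf_ok : boundary_rhs gf (x tf) sb)
  (pb := OCP E F f U (S0 `*` Sf))
  (w := Process x u t0 tf (sa, xa, sa0) (sb, xb, sb0))
  (w_optimal : optimal p q pb w)
  (nu0 : R) (lam : R -> 'rV[R]_Nx)
  (w_pontryagin : pontryagin pb w nu0 lam)
  (psi0 psif : 'rV[R]_Nx)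
  (psi0_def : - psi0 = lam t0 + nu0 *:
     grad (fun x0 => E ((x0, t0, (sa, xa, sa0)), (x tf, tf, (sb, xb, sb0))))
       (x t0))
  (psif_def : psif = lam tf - nu0 *:
     grad (fun xf => E ((x t0, t0, (sa, xa, sa0)), (xf, tf, (sb, xb, sb0))))
       (x tf)) :
  exists nut0 nutf : R,
    interval_normal_cone t0L t0U t0 nut0 /\
    interval_normal_cone tfL tfU tf nutf /\
    dot psi0 (g0 (x t0) sa) = 0 /\
    lower_hamiltonian_at pb w nu0 lam t0 =
      nu0 * derive1 (fun t => E ((x t0, t, (sa, xa, sa0)),
                                 (x tf, tf, (sb, xb, sb0)))) t0 + nut0 /\
    dot psif (gf (x tf) sb) = 0 /\
    - lower_hamiltonian_at pb w nu0 lam tf =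
      nu0 * derive1 (fun t => E ((x t0, t0, (sa, xa, sa0)),
                                 (x tf, t, (sb, xb, sb0)))) tf + nutf.
Proof.
set E0 := fun x0 => E ((x0, t0, (sa, xa, sa0)), _) in psi0_def.
set Ef := fun xf => E (_, (xf, tf, (sb, xb, sb0))) in psif_def.
pose e0 t := E ((x t0, t, (sa, xa, sa0)), (x tf, tf, (sb, xb, sb0))).
pose ef t := E ((x t0, t0, (sa, xa, sa0)), (x tf, t, (sb, xb, sb0))).
rewrite -/e0 -/ef.
have [_ _ _ _ /limiting_normal_cone_prod[cone0 conef]] := w_pontryagin.
pose z := endpoints w.
have dE : differentiable E z by have [dE _] := E_C1.
(* On the tested directions the parameters vary only in their local times, along which [F] is
   constant, so the integral term of [endpoint_form] vanishes. *)
have F0 b b' : Rintegral lebesgue_measure `[t0, tf] (fun t =>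
    'D_((0, 0, 0, (b, 0, 0), (b', 0, 0)) :
          'rV[R]_Nx * 'rV[R]_Nu * R * param R Nx * param R Nx) F
      (x t, u t, t, (sa, xa, sa0), (sb, xb, sb0))) = 0.
  apply: Rintegral_eq0 => t; apply: derive_line_cst => a.
  rewrite (_ : _ + _ = (x t, u t, t, (a * b + sa, xa, sa0),
    (a * b' + sb, xb, sb0))); first exact: F_indep.
  by rewrite !pair_linearE !scaler0 !add0r.
have E_time (a b : R) : 'D_((((0, 0, (a, 0, 0)), (0, 0, (b, 0, 0)))) :
    endpoint R Nx * endpoint R Nx) E z = 0.
  apply: derive_line_cst => c.
  rewrite (_ : _ + _ = ((x t0, t0, (c * a + sa, xa, sa0)),
    (x tf, tf, (c * b + sb, xb, sb0)))); first exact: E_indep.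
  by rewrite !pair_linearE !scaler0 !add0r.
have DE v a b v' a' b' :
    'D_(((v, a, (b, 0, 0)), (v', a', (b', 0, 0))) :
      endpoint R Nx * endpoint R Nx) E z =
    dot (grad E0 (x t0)) v + a * derive1 e0 t0
    + (dot (grad Ef (x tf)) v' + a' * derive1 ef tf).
  pose dt0 : endpoint R Nx * endpoint R Nx := ((0, 1, 0), 0).
  pose dtf : endpoint R Nx * endpoint R Nx := (0, (0, 1, 0)).
  have -> : derive1 e0 t0 = 'D_dt0 E z.
    rewrite derive1E; symmetry; apply: derive_line_ext => c.
    by rewrite !pair_linearE !scaler0 !add0r.
  have -> : derive1 ef tf = 'D_dtf E z.
    rewrite derive1E; symmetry; apply: derive_line_ext => c.
    by rewrite !pair_linearE !scaler0 !add0r.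
  rewrite (@dot_grad _ _ _ E _ z (in_left \o (in_left \o in_left))) //;
    last first.
    by move=> y; rewrite /= /in_left !pair_linearE !add0r.
  rewrite (@dot_grad _ _ _ E _ z (in_right \o (in_left \o in_left))) //;
    last first.
    by move=> y; rewrite /= /in_left /in_right !pair_linearE !add0r.
  (* The zero derivative along the local times is added back, so that all five directions sum to the
     full one under the linear map ['d E z]. *)
  rewrite -[RHS]addr0 -[X in _ = _ + X](E_time b b') !deriveE //.
  rewrite -[a * _]linearZ -[a' * _]linearZ.
  rewrite -!linearD; congr ('d E z _).
  rewrite /= /in_left /in_right !pair_linearE !scaler0 !addr0 !add0r.
  by rewrite [a *: 1]mulr1 [a' *: 1]mulr1.
pose H0 := lower_hamiltonian_at pb w nu0 lam t0.
pose Hf := lower_hamiltonian_at pb w nu0 lam tf.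
have formE v a b v' a' b' :
    endpoint_form pb w nu0 lam ((v, a, (b, 0, 0)), (v', a', (b', 0, 0))) =
    nu0 * (dot (grad E0 (x t0)) v + a * derive1 e0 t0
      + (dot (grad Ef (x tf)) v' + a' * derive1 ef tf))
    + dot (lam t0) v - H0 * a - dot (lam tf) v' + Hf * a'.
  by rewrite /endpoint_form DE F0 mulr0 addr0.
(* The normal to one factor is minus [endpoint_form] with zero variation at the other end; this
   agrees with the composition with [in_left] or [in_right] by conversion. *)
have time0 : interval_normal_cone t0L t0U t0 (- endpoint_form pb w nu0 lam
    ((0, 1, (0, 0, 0)), (0, 0, (0, 0, 0)))) := boundary_set_limiting_time cone0.
have timef : interval_normal_cone tfL tfU tf (- endpoint_form pb w nu0 lam
    ((0, 0, (0, 0, 0)), (0, 1, (0, 0, 0)))) := boundary_set_limiting_time conef.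
have ode0 : - endpoint_form pb w nu0 lam
    ((g0 (x t0) sa, 0, (1, 0, 0)), (0, 0, (0, 0, 0))) = 0.
  exact: boundary_set_limiting_ode (boundary_rhs_continuous g0_ok) cone0.
have odef : - endpoint_form pb w nu0 lam
    ((0, 0, (0, 0, 0)), (gf (x tf) sb, 0, (1, 0, 0))) = 0.
  exact: boundary_set_limiting_ode (boundary_rhs_continuous gf_ok) conef.
move: time0 timef ode0 odef; rewrite !formE !dot0r => time0 timef ode0 odef.
(* The multipliers are the normals evaluated on the clock directions: [H0 - nu0 * derive1 e0 t0] and
   [- Hf - nu0 * derive1 ef tf], up to zero terms. *)
do 2!eexists; split; first exact: time0.
split; first exact: timef.
(* With the weak covectors unfolded, [dot psi0] and [dot psif] on the boundary fields are, up to
   sign, the quantities that [ode0] and [odef] equate to zero. *)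
rewrite -[psi0]opprK psi0_def psif_def !(dotNl, dotDl, dotZl).
by repeat split; rewrite -/H0 -/Hf; lra.
Qed.
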